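(* As $n\to\infty$, the proportion of MPTQ subsets of $\{1,2,\ldots,n\}$ approaches $0$; that is, $$\lim_{n\to\infty}\frac{\big|\{A\subseteq\{1,2,\ldots,n\} : A\text{ is MPTQ}\}\big|}{2^n}=0.$$
   Context: For a finite set $A\subset\mathbb{R}\setminus\{0\}$, define $A\cdot A=\{ab \mid a,b\in A\}$ and $A/A=\{a/b\mid a,b\in A\}$. The set $A$ is MPTQ (more product than quotient) if $|A\cdot A|>|A/A|$. *)

(* Defs.v *)
From mathcomp Require Import all_boot all_order all_algebra.
From mathcomp Require Import finmap.
From mathcomp Require Import all_classical all_reals all_analysis.
Set Implicit Arguments.
Unset Strict Implicit.
Unset Printing Implicit Defensive.
Import Order.TTheory GRing.Theory Num.Theory.
Import numFieldNormedType.Exports.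
Local Open Scope fset_scope.
Local Open Scope ring_scope.

Section MPTQ.
Variable R : realType.
Implicit Type A : {fset R}.

Definition product_set A : {fset R} := [fset a * b | a in A, b in A].

Definition quotient_set A : {fset R} := [fset a / b | a in A, b in A].

(* The first conjunct is the standing restriction to sets of nonzero reals. *)
Definition MPTQ A : bool :=
  (0 \notin A) && (#|` quotient_set A| < #|` product_set A|)%N.

Definition initial_segment (n : nat) : {fset R} :=
  [fset k%:R | k in iota 1 n].

Definition MPTQ_subsets (n : nat) : {fset {fset R}} :=
  [fset A in fpowerset (initial_segment n) | MPTQ A].

End MPTQ.

(* Main.v *)
(** If C is the number of coprime ordered pairs in A x A, then |A/A| >= C since
    reduced fractions are distinct, while |A.A| <= (|A|^2 + |A|)/2; so A is not
    MPTQ as soon as 2C - |A|^2 >= |A|.  The left side is the sum over A x A of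
    the sign +1 (coprime) or -1 (not coprime).  A non-coprime pair is divisible
    by 2, by 3 or by some odd d >= 5, and 1/4 + 1/9 + sum_(odd d >= 5) 1/d^2
    <= 35/72 < 1/2, so for uniformly random A the mean of this sum is at least
    n^2/144 - n/4.  Two pairs with disjoint supports are uncorrelated, so its
    variance is at most 4 n^3, and Chebyshev's inequality bounds the proportion
    of exceptional A by O(1/n). *)

Require Import Defs.
From mathcomp Require Import all_boot all_order all_algebra.
From mathcomp Require Import finmap.
From mathcomp Require Import all_classical all_reals all_analysis.
From mathcomp Require Import ring lra zify.
Import Order.TTheory GRing.Theory Num.Theory.
Import numFieldNormedType.Exports.
Local Open Scope ring_scope.

(** * Moments of a weighted count over uniformly random subsets *)

Lemma card_supersets (T : finType) (B : {set T}) :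
  #|[set A : {set T} | B \subset A]%SET| = (2 ^ (#|T| - #|B|))%N.
Proof.
(* Complementation carries the supersets of [B] to the subsets of its complement. *)
rewrite -(cardsC B) addKn -card_powerset -[RHS](card_imset _ (@finset.setC_inj T)).
apply: eq_card => A; rewrite inE; apply/idP/imsetP => [BA|[C]].
  by exists (finset.setC A); rewrite ?finset.setCK // powersetE finset.setCS.
by rewrite powersetE => CB ->; rewrite -(finset.setCK B) finset.setCS.
Qed.

Section SecondMoment.
Variables (R : realFieldType) (T I : finType) (supp : I -> {set T}) (w : I -> R).

(* For random A, [weight_in A] is a linear combination of the indicators of
   [supp i \subset A], each of probability [2 ^- #|supp i|]. *)
Definition weight_in (A : {set T}) : R := \sum_i w i * (supp i \subset A)%:R.

Definition mean_weight : R := \sum_i w i / 2 ^+ #|supp i|.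

Lemma sum_supersets (B : {set T}) :
  \sum_(A : {set T}) (B \subset A)%:R = 2 ^+ #|T| / 2 ^+ #|B| :> R.
Proof.
rewrite -natr_sum -big_mkcond /= sum1dep_card card_supersets natrX.
by rewrite exprB ?unitfE ?pnatr_eq0 // max_card.
Qed.

Lemma sum_weight_in : \sum_(A : {set T}) weight_in A = 2 ^+ #|T| * mean_weight.
Proof.
rewrite exchange_big /= mulr_sumr; apply: eq_bigr => i _.
by rewrite -mulr_sumr sum_supersets mulrCA.
Qed.

Lemma sum_weight_in_sqr :
  \sum_(A : {set T}) weight_in A ^+ 2 =
  2 ^+ #|T| * \sum_i \sum_j w i * w j / 2 ^+ #|supp i :|: supp j|.
Proof.
under eq_bigr do rewrite expr2 mulr_suml.
rewrite exchange_big /= mulr_sumr; apply: eq_bigr => i _.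
under eq_bigr do rewrite mulr_sumr.
rewrite exchange_big /= mulr_sumr; apply: eq_bigr => j _.
under eq_bigr do rewrite mulrACA -natrM mulnb -finset.subUset.
by rewrite -mulr_sumr sum_supersets mulrCA.
Qed.

(** The covariance of the indicators of [supp i] and [supp j] vanishes for disjoint supports, where
    the exponents add up; otherwise it is a difference of two numbers in [0, 1]. *)
Lemma variance_weight_in_le (w_le1 : forall i, `|w i| <= 1) :
  \sum_(A : {set T}) (weight_in A - mean_weight) ^+ 2 <=
  2 ^+ #|T| * \sum_i \sum_j (~~ [disjoint supp i & supp j])%:R.
Proof.
have -> : \sum_(A : {set T}) (weight_in A - mean_weight) ^+ 2 =
    2 ^+ #|T| * \sum_i \sum_j w i * w j *
      ((2 ^+ #|supp i :|: supp j|)^-1 - (2 ^+ #|supp i|)^-1 * (2 ^+ #|supp j|)^-1).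
  under eq_bigr do rewrite sqrrB.
  rewrite big_split sumrB /= sum_weight_in_sqr sumrMnl -mulr_suml sum_weight_in.
  rewrite sumr_const.
  have -> : #|{: {set T}}| = (2 ^ #|T|)%N.
    have := card_supersets T finset.set0; rewrite cards0 subn0 => <-.
    by apply: eq_card => A; rewrite !inE finset.sub0set.
  rewrite -[_ *+ (2 ^ _)]mulr_natl natrX.
  have -> (x y z : R) : z * x - z * y * y *+ 2 + z * y ^+ 2 = z * (x - y * y) by ring.
  congr (_ * _); rewrite [X in _ - X * _]/mean_weight mulr_suml -sumrB.
  apply: eq_bigr => i _; rewrite mulr_sumr -sumrB; apply: eq_bigr => j _.
  by rewrite mulrBr mulrACA.
rewrite ler_wpM2l ?exprn_ge0 //; apply: ler_sum => i _; apply: ler_sum => j _.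
have [dij|_] /= := boolP [disjoint supp i & supp j].
  by rewrite cardsU (disjoint_setI0 dij) cards0 subn0 exprD invfM subrr mulr0.
apply: le_trans (ler_norm _) _; rewrite !normrM.
have inv01 k : 0 <= (2 ^+ k : R)^-1 <= 1.
  by rewrite invr_ge0 exprn_ge0 //= invf_le1 ?exprn_gt0 // exprn_ege1 // ler1n.
rewrite mulr_ile1 ?mulr_ge0 ?mulr_ile1 //.
have /andP[x0 x1] := inv01 #|supp i :|: supp j|.
have /andP[y0 y1] := inv01 #|supp i|; have /andP[z0 z1] := inv01 #|supp j|.
have := mulr_ge0 y0 z0; have := mulr_ile1 y0 z0 y1 z1.
by rewrite ler_norml; lra.
Qed.

End SecondMoment.

(** * Coprime pairs in a random subset of {1, ..., n} *)

Section CoprimePairs.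
Variables (R : realFieldType) (n : nat).

(** The ordinal [i] stands for the integer [i.+1], so ['I_n] encodes {1, ..., n}. *)
Definition coprime_sign (p : 'I_n * 'I_n) : R :=
  if coprime p.1.+1 p.2.+1 then 1 else -1.

Definition pair_support (p : 'I_n * 'I_n) : {set 'I_n} := [set p.1; p.2]%SET.

Definition coprime_pairs (A : {set 'I_n}) : {set 'I_n * 'I_n} :=
  [set p | [&& p.1 \in A, p.2 \in A & coprime p.1.+1 p.2.+1]]%SET.

(** The sets whose coprime pairs are too few to rule out MPTQ by counting. *)
Definition bad_sets : {set {set 'I_n}} :=
  [set A | (2 * #|coprime_pairs A| < #|A| ^ 2 + #|A|)%N]%SET.

(** A common prime factor is 2, 3 or of the form 2k + 5, and being at most n it has k < n. Composite
    values of 2k + 5 can only enlarge the right side. *)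
Lemma noncoprime_le (a b : nat) : (0 < a <= n)%N ->
  (~~ coprime a b <=
   (2 %| a) * (2 %| b) + (3 %| a) * (3 %| b) +
   \sum_(k < n) (k.*2 + 5 %| a) * (k.*2 + 5 %| b))%N.
Proof.
case/andP=> a_gt0 a_le; have [//|nab] := boolP (coprime a b).
have g_gt1 : (1 < gcdn a b)%N.
  by rewrite ltn_neqAle eq_sym nab gcdn_gt0 a_gt0.
have [p p_pr /[!dvdn_gcd] /andP[pa pb]] : exists2 p, prime p & (p %| gcdn a b)%N.
  by exists (pdiv (gcdn a b)); rewrite ?pdiv_prime ?pdiv_dvd.
have p_le := leq_trans (dvdn_leq a_gt0 pa) a_le.
have [p2|p_odd] := even_prime p_pr; first by rewrite -p2 pa pb.
have [p3|p_neq3] := eqVneq p 3%N; first by rewrite -p3 pa pb addnAC leq_addl.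
have p_gt1 := prime_gt1 p_pr.
have [k pk] : exists k, p = (k.*2 + 5)%N.
  have := odd_double_half p; rewrite p_odd => pE.
  (* Here p is at least 5, so the subtraction does not truncate. *)
  by exists (p./2 - 2)%N; lia.
have k_lt : (k < n)%N by lia.
by rewrite (bigD1 (Ordinal k_lt)) //= -pk pa pb addnCA leq_addr.
Qed.

Lemma sum_dvdn_pairs d :
  (\sum_(a < n) \sum_(b < n) (d %| a.+1) * (d %| b.+1) = (n %/ d) ^ 2)%N.
Proof.
under eq_bigr do rewrite -big_distrr /=.
by rewrite -big_distrl /= divn_count_dvd big_add1 /= big_mkord.
Qed.

Lemma sum_noncoprime_le :
  (\sum_(a < n) \sum_(b < n) ~~ coprime a.+1 b.+1 <=
   (n %/ 2) ^ 2 + (n %/ 3) ^ 2 + \sum_(k < n) (n %/ (k.*2 + 5)) ^ 2)%N.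
Proof.
apply: (@leq_trans (\sum_(a < n) \sum_(b < n)
   ((2 %| a.+1) * (2 %| b.+1) + (3 %| a.+1) * (3 %| b.+1) +
   \sum_(k < n) (k.*2 + 5 %| a.+1) * (k.*2 + 5 %| b.+1))%N)).
  by do 2![apply: leq_sum => ? _]; apply: noncoprime_le; rewrite /= ltn_ord.
under eq_bigr do rewrite !big_split /=.
rewrite !big_split /= !sum_dvdn_pairs leq_add2l.
under eq_bigr do rewrite exchange_big /=.
by rewrite exchange_big /=; apply: leq_sum => k _; rewrite sum_dvdn_pairs.
Qed.

(* Telescoping: 1/d^2 <= 1/((d - 1)(d + 1)). *)
Lemma sum_inv_odd_sqr_le m :
  \sum_(k < m) ((k.*2 + 5)%:R ^+ 2)^-1 <= 8^-1 :> R.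
Proof.
suff : \sum_(k < m) ((k.*2 + 5)%:R ^+ 2)^-1 <= 8^-1 - (4 * (m + 2)%:R)^-1 :> R.
  move/le_trans; apply; by rewrite gerBl invr_ge0 mulr_ge0.
elim: m => [|m IH]; first by rewrite big_ord0 add0n; lra.
rewrite big_ord_recr /=; apply: le_trans (lerD IH (lexx _)) _.
have x0 : 0 <= m%:R :> R by [].
rewrite -muln2 !natrD natrM -[m.+1]addn1 natrD; set x := m%:R in x0 *.
rewrite -addrA lerD2l -subr_ge0.
have -> : - (4 * (x + 1 + 2))^-1 - (- (4 * (x + 2))^-1 + ((x * 2 + 5) ^+ 2)^-1) =
  (4 * (x + 2) * (x + 3) * (x * 2 + 5) ^+ 2)^-1.
  by field; do ?[apply/andP; split]; apply/lt0r_neq0; lra.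
by rewrite invr_ge0 !mulr_ge0 ?exprn_ge0 //; lra.
Qed.

(** The constant is 1/4 + 1/9 + 1/8 = 35/72. *)
Lemma noncoprime_density :
  \sum_(a < n) \sum_(b < n) (~~ coprime a.+1 b.+1)%:R <= 35 / 72 * n%:R ^+ 2 :> R.
Proof.
have divle d : (n %/ d)%:R ^+ 2 <= n%:R ^+ 2 * (d%:R ^+ 2)^-1 :> R.
  have [->|d_gt0] := posnP d; first by
    rewrite divn0 expr2 mul0r mulr_ge0 ?invr_ge0 ?exprn_ge0.
  rewrite -exprVn -exprMn lerXn2r ?nnegrE ?mulr_ge0 ?invr_ge0 //.
  by rewrite ler_pdivlMr ?ltr0n // -natrM ler_nat leq_divM.
have := sum_noncoprime_le; rewrite -(ler_nat R) natr_sum.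
under eq_bigr do rewrite natr_sum.
move/le_trans; apply; rewrite !natrD !natrX natr_sum.
apply: (@le_trans _ _ (n%:R ^+ 2 * (2 ^+ 2)^-1 + n%:R ^+ 2 * (3 ^+ 2)^-1 +
    n%:R ^+ 2 * \sum_(k < n) ((k.*2 + 5)%:R ^+ 2)^-1)).
  rewrite mulr_sumr !lerD ?divle //; apply: ler_sum => k _.
  by rewrite natrX divle.
rewrite -!mulrDr mulrC ler_wpM2r ?exprn_ge0 //.
by have := sum_inv_odd_sqr_le n; lra.
Qed.

Lemma sum_delta (x : 'I_n) : \sum_(y < n) (x == y)%:R = 1 :> R.
Proof.
by rewrite (bigD1 x) //= eqxx big1 ?addr0 // => y /negPf; rewrite eq_sym => ->.
Qed.

Lemma mean_coprime_sign_ge :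
  n%:R ^+ 2 / 144 - n%:R / 4 <= mean_weight R _ _ pair_support coprime_sign.
Proof.
(* Off the diagonal the summand is exact: the pair lies in A with probability 1/4. A diagonal pair
   has a one-element support, hence probability 1/2, and the extra -1/4 covers its non-coprime
   case. *)
apply: (@le_trans _ _ (\sum_(p : 'I_n * 'I_n)
    (1 / 4 - (~~ coprime p.1.+1 p.2.+1)%:R / 2 - (p.1 == p.2)%:R / 4))).
  rewrite !sumrB -!mulr_suml sumr_const card_prod card_ord.
  rewrite -(pair_bigA _ (fun a b : 'I_n => (~~ coprime a.+1 b.+1)%:R)) /=.
  rewrite -(pair_bigA _ (fun a b : 'I_n => (a == b)%:R)) /=.
  have -> : \sum_(a < n) \sum_(b < n) (a == b)%:R = n%:R :> R.
    under eq_bigr do rewrite sum_delta.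
    by rewrite sumr_const card_ord.
  rewrite -[_ *+ (n * n)]mulr_natr natrM.
  by have := noncoprime_density; lra.
apply: ler_sum => -[a b] _; rewrite /coprime_sign /pair_support cards2 /=.
by case: (coprime _ _); case: (a == b) => /=; rewrite ?expr1 ?expr2; lra.
Qed.

(** Overlapping pairs agree in one of four choices of coordinates, and each agreement leaves n^3
    possibilities. *)
Lemma sum_overlap_le :
  \sum_p \sum_q (~~ [disjoint pair_support p & pair_support q])%:R
    <= 4 * n%:R ^+ 3 :> R.
Proof.
have cardn (x : R) : \sum_(y < n) x = n%:R * x.
  by rewrite sumr_const card_ord mulr_natl.
apply: (@le_trans _ _ (\sum_(p : 'I_n * 'I_n) \sum_(q : 'I_n * 'I_n)
   ((p.1 == q.1)%:R + (p.1 == q.2)%:R + (p.2 == q.1)%:R + (p.2 == q.2)%:R))).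
  apply: ler_sum => -[a b] _; apply: ler_sum => -[c d] _ /=.
  rewrite -!natrD ler_nat -setI_eq0; case: set0Pn => //= -[x].
  rewrite !inE /= => /andP[/orP[]/eqP <- /orP[]/eqP <-]; rewrite eqxx; lia.
under eq_bigr => p _.
  rewrite -(pair_bigA _ (fun c d : 'I_n => (p.1 == c)%:R + (p.1 == d)%:R +
    (p.2 == c)%:R + (p.2 == d)%:R)) /=.
  under eq_bigr do rewrite !big_split /= !sum_delta !cardn.
  rewrite !big_split /= -!mulr_sumr !sum_delta !cardn.
  over.
rewrite sumr_const card_prod card_ord -[_ *+ (n * n)]mulr_natl natrM.
by rewrite le_eqVlt; apply/orP; left; apply/eqP; ring.
Qed.

Lemma weight_coprime_sign (A : {set 'I_n}) :
  weight_in R _ _ pair_support coprime_sign A =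
  (2 * #|coprime_pairs A|)%:R - (#|A| ^ 2)%:R.
Proof.
have -> : (#|A| ^ 2 = \sum_p (pair_support p \subset A))%N.
  rewrite expnS expn1 -cardsX -sum1_card big_mkcond /=; apply: eq_bigr => -[a b] _.
  by rewrite finset.subUset !finset.sub1set finset.in_setX; case: ifP.
rewrite natrM -sum1_card big_mkcond /= !natr_sum mulr_sumr -sumrB.
apply: eq_bigr => -[a b] _; rewrite /coprime_sign inE /= finset.subUset !finset.sub1set.
by case: (a \in A); case: (b \in A); case: (coprime _ _) => /=; lra.
Qed.

Lemma bad_sets_density : (360 <= n)%N ->
  #|bad_sets|%:R / 2 ^+ n <= 576 ^+ 2 / n%:R :> R.
Proof.
move=> n_ge; have x_ge : 360 <= n%:R :> R by rewrite ler_nat.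
have sign_le1 p : `|coprime_sign p| <= 1.
  by rewrite /coprime_sign; case: ifP; rewrite ?normrN normr1.
have := variance_weight_in_le R _ _ pair_support coprime_sign sign_le1.
have := sum_overlap_le; have := mean_coprime_sign_ge.
set mu := mean_weight _ _ _ _ _; rewrite card_ord; set D := \sum_p _ => mu_ge D_le var_le.
(* Chebyshev: a bad set has weight below n, and n >= 360 is what makes n^2/144 - n/4 - n at least
   n^2/288. The final constant is 4 * 288^2 = 576^2. *)
have : #|bad_sets|%:R * (n%:R ^+ 2 / 288) ^+ 2 <= 2 ^+ n * (4 * n%:R ^+ 3) :> R.
  apply: le_trans (le_trans var_le _); last by rewrite ler_wpM2l ?exprn_ge0.
  rewrite -sum1_card natr_sum mulr_suml big_mkcond /=; apply: ler_sum => A _.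
  case: ifP; last by rewrite sqr_ge0.
  rewrite inE -(ltr_nat R) natrD => badA; rewrite mul1r -[leRHS]sqrrN opprB.
  have w_lt : weight_in R _ _ pair_support coprime_sign A < n%:R.
    rewrite weight_coprime_sign ltrBlDl (lt_le_trans badA) // lerD2l ler_nat.
    by rewrite -[X in (_ <= X)%N]card_ord max_card.
  have x2 : 360 * n%:R <= n%:R ^+ 2 :> R by rewrite expr2 ler_wpM2r.
  by rewrite lerXn2r ?nnegrE; lra.
have x_gt0 : 0 < n%:R :> R by lra.
move=> le1; rewrite ler_pdivrMr ?exprn_gt0 // mulrAC ler_pdivlMr //.
have x3 : 0 < n%:R ^+ 3 :> R by rewrite exprn_gt0.
rewrite -(ler_pM2r x3); lra.
Qed.

End CoprimePairs.

(** * Transfer from sets of indices to finite sets of reals *)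

Section RealSets.
Variables (R : realType) (n : nat).
Implicit Type A : {set 'I_n}.

Definition values A : {fset R} := [fset (i.+1)%:R | i : 'I_n in A]%fset.

Lemma values_mem A (i : 'I_n) : (i.+1%:R \in values A) = (i \in A).
Proof.
apply/imfsetP/idP => [[j /= jA /eqP]|iA]; last by exists i.
by rewrite eqr_nat eqSS => /eqP/val_inj ->.
Qed.

(** The weakly increasing pairs and their mirror images cover A x A and meet exactly in the
    diagonal. *)
Lemma card_ordered_pairs A :
  (2 * #|[set p : 'I_n * 'I_n | [&& p.1 \in A, p.2 \in A & p.1 <= p.2]]%SET| =
   #|A| ^ 2 + #|A|)%N.
Proof.
set L := [set p | _]%SET.
pose U := [set p : 'I_n * 'I_n | [&& p.1 \in A, p.2 \in A & (p.2 <= p.1)%N]]%SET.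
have UE : #|U| = #|L|.
  have swapK : involutive (fun p : 'I_n * 'I_n => (p.2, p.1)) by case.
  rewrite -(card_preimset L (inv_inj swapK)); apply: eq_card => -[a b].
  by rewrite !inE /= andbCA.
have -> : (#|A| ^ 2 = #|L :|: U|)%N.
  rewrite expnS expn1 -cardsX; apply: eq_card => -[a b]; rewrite !inE /=.
  by case: (a \in A); case: (b \in A) => //=; rewrite leq_total.
have -> : #|A| = #|L :&: U|.
  have dinj : injective (fun a : 'I_n => (a, a)) by move=> a b [].
  rewrite -(card_imset _ dinj); apply: eq_card => -[a b]; rewrite !inE /=.
  apply/imsetP/idP => [[c cA [-> ->]]|]; first by rewrite cA leqnn.
  move=> /andP[/and3P[aA bA ab] /and3P[_ _ ba]]; exists a => //.
  by congr pair; apply/val_inj/eqP; rewrite eqn_leq ba.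
by rewrite cardsUI UE mul2n addnn.
Qed.

Lemma card_product_set A :
  (2 * #|` product_set (values A)| <= #|A| ^ 2 + #|A|)%N.
Proof.
rewrite -card_ordered_pairs leq_mul2l /= cardE.
set L := [set p | _]%SET.
apply: leq_trans (leq_imfset_card imfset_key
  (fun p : 'I_n * 'I_n => (p.1.+1)%:R * (p.2.+1)%:R : R) (mem L)).
apply: fsubset_leq_card; apply/fsubsetP => x /imfset2P[u /imfsetP[a /= aA uE]].
case=> v /imfsetP[b /= bA vE] ->; rewrite uE vE; apply/imfsetP => /=.
have [ab|/ltnW ba] := leqP a b.
  by exists (a, b) => //; rewrite inE /= aA bA.
by exists (b, a); rewrite 1?mulrC // inE /= aA bA.
Qed.

(** After cross-multiplication, Gauss's lemma makes [a] and [c] divide each other. *)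
Lemma coprime_ratio_inj (a b c d : nat) :
  (0 < a)%N -> (0 < b)%N -> (0 < c)%N -> (0 < d)%N ->
  coprime a b -> coprime c d -> a%:R / b%:R = c%:R / d%:R :> R ->
  a = c /\ b = d.
Proof.
move=> a0 b0 c0 d0 ab cd /eqP.
rewrite eqr_div ?pnatr_eq0 -?lt0n // -!natrM eqr_nat => /eqP e.
have ac : a = c.
  apply/eqP; rewrite eqn_dvd -(Gauss_dvdl _ ab) -e dvdn_mulr //=.
  by rewrite -(Gauss_dvdl _ cd) e dvdn_mulr.
split=> //; apply/eqP; move/eqP: e.
by rewrite ac eqn_pmul2l // eq_sym.
Qed.

Lemma card_quotient_set A :
  (#|coprime_pairs n A| <= #|` quotient_set (values A)|)%N.
Proof.
rewrite cardE -(@card_in_imfset imfset_key _ _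
  (fun p : 'I_n * 'I_n => (p.1.+1)%:R / (p.2.+1)%:R : R) (mem (coprime_pairs n A))).
  apply: fsubset_leq_card; apply/fsubsetP => x /imfsetP[[a b] /= + ->].
  rewrite inE /= => /and3P[aA bA _].
  by apply: in_imfset2; rewrite ?values_mem.
move=> [a b] [c d]; rewrite !inE /= => /and3P[_ _ ab] /and3P[_ _ cd] e.
have [//|//|//|//|[ac] [bd]] := coprime_ratio_inj _ _ _ _ _ _ _ _ ab cd e.
by congr pair; apply: val_inj.
Qed.

Lemma card_MPTQ_subsets : (#|` MPTQ_subsets R n| <= #|bad_sets n|)%N.
Proof.
rewrite [leqRHS]cardE.
apply: leq_trans (leq_imfset_card imfset_key values (mem (bad_sets n))).
apply: fsubset_leq_card; apply/fsubsetP => B.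
rewrite !inE /= fpowersetE => /andP[/fsubsetP Bn /andP[_ B_mptq]].
pose A := [set i : 'I_n | (i.+1)%:R \in B]%SET.
(* Every element of [B] is an integer k with 1 <= k <= n, hence comes from the ordinal k - 1. *)
have BE : B = values A.
  apply/fsetP => x; apply/idP/imfsetP => [xB|[i /= + ->]]; last by rewrite inE.
  have /imfsetP[k /= + xk] := Bn x xB; rewrite mem_iota add1n ltnS => /andP[k0 kn].
  have i_lt : (k.-1 < n)%N by rewrite prednK.
  by exists (Ordinal i_lt); rewrite /= ?inE /= prednK // -xk.
apply/imfsetP; exists A => //=; rewrite inE.
rewrite BE in B_mptq.
apply: leq_trans (card_product_set A); rewrite ltn_mul2l /=.
exact: leq_ltn_trans (card_quotient_set A) B_mptq.
Qed.

End RealSets.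

(** * The limit, by squeezing *)

Local Open Scope classical_set_scope.
Local Open Scope fset_scope.
Local Open Scope ring_scope.

Theorem theorem1p3 (R : realType) :
  (fun n : nat => #|` MPTQ_subsets R n|%:R / 2 ^+ n : R) @ \oo --> (0 : R).
Proof.
have lim0 : (fun n : nat => 576 ^+ 2 / n%:R : R) @ \oo --> (0 : R).
  rewrite -(mulr0 (576 ^+ 2)); apply: cvgMl_tmp.
  (* The harmonic sequence is 1/(n + 1), hence the shift of index. *)
  by rewrite -cvg_shiftS; exact: cvg_harmonic.
apply: (squeeze_cvgr _ (cvg_cst 0) lim0).
near=> n.
rewrite divr_ge0 ?exprn_ge0 //=.
apply: le_trans (bad_sets_density R n _); last by near: n; exact: nbhs_infty_ge.
by rewrite ler_pM2r ?invr_gt0 ?exprn_gt0 // ler_nat card_MPTQ_subsets.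
Unshelve. all: by end_near.
Qed.
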